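(* Let $k$ be an odd positive integer. Then for every $n\in\mathbb{Z}_{\ge 0}$, $$\sum_{i=1}^n i^{\frac{k}{2}} = C_k + \sqrt{n}\,P_k(n) + \sum_{\substack{3\le i\le k+2\\ i\text{ odd}}} A^k_i\,\tau(n,i),$$ where (1) $P_k(n)$ is the polynomial in $n$ $$P_k(n) := \frac{1}{\frac{k}{2}+1}\sum_{i=0}^{\frac{k+1}{2}} \binom{\frac{k}{2}+1}{i} (-1)^i B_i\, n^{\frac{k+1}{2}-i};$$ (2) $A^k_i$, for $i\in\{1,3,5,\dots,k+2\}$, are the constants $$A^k_i := \frac{1}{(\frac{k}{2}+1)2^{i-1}}\sum_{j=0}^{\frac{k-i}{2}+1}\binom{2j+i}{j}\frac{1}{4^j}\binom{\frac{k}{2}+1}{\frac{k-i}{2}+1-j}B_{\frac{k-i}{2}+1-j};$$ (3) $C_k$ is the constant $$C_k := 1 - P_k(1) - \sum_{\substack{3\le i\le k+2\\ i\text{ odd}}} A^k_i\,\tau(1,i).$$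
   Context: $\mathbb{Z}_{\ge 0}$ is the set of nonnegative integers. $B_i$ denotes the $i$-th Bernoulli number, with the convention $B_1=-\frac12$. For real $\alpha$ and integer $i\ge 0$, $\binom{\alpha}{i}=\frac{\alpha(\alpha-1)\cdots(\alpha-i+1)}{i!}$ is the generalized binomial coefficient. For $n,m\in\mathbb{Z}_{\ge0}$ with $m\ge 3$, Ramanujan's function is the convergent series $$\tau(n,m):=\sum_{\nu=0}^{\infty} \frac{1}{(\sqrt{n+\nu}+\sqrt{n+\nu+1})^m}.$$ *)

(* Defs.v *)
(* MathComp / MathComp-Analysis *)
From HB Require Import structures.
From mathcomp Require Import all_boot all_order all_algebra.
From mathcomp Require Import all_classical all_reals all_analysis.

Set Implicit Arguments.
Unset Strict Implicit.
Unset Printing Implicit Defensive.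

Import Order.TTheory GRing.Theory Num.Theory.
Import numFieldNormedType.Exports.

Local Open Scope ring_scope.

(* [:: B_0; ...; B_n], where B_0 = 1 and, for n > 0,
   B_n = - 1/(n+1) * \sum_(i < n) 'C(n+1, i) B_i; hence B_1 = -1/2. *)
Fixpoint bernoulli_seq (n : nat) : seq rat :=
  if n is m.+1 then
    let s := bernoulli_seq m in
    rcons s (- (m.+2%:R)^-1 * \sum_(i < m.+1) 'C(m.+2, i)%:R * s`_i)
  else [:: 1].

Definition bernoulli (n : nat) : rat := (bernoulli_seq n)`_n.

Lemma size_bernoulli_seq n : size (bernoulli_seq n) = n.+1.
Proof. by elim: n => //= n IHn; rewrite size_rcons IHn. Qed.

Lemma nth_bernoulli_seq n i : (i <= n)%N -> (bernoulli_seq n)`_i = bernoulli i.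
Proof.
elim: n => [|n IHn]; first by rewrite leqn0 => /eqP ->.
rewrite leq_eqVlt => /predU1P[-> //|]; rewrite ltnS => le_in /=.
by rewrite nth_rcons size_bernoulli_seq ltnS le_in IHn.
Qed.

Lemma bernoulli_rec n :
  \sum_(i < n.+1) 'C(n.+1, i)%:R * bernoulli i = (n == 0)%:R.
Proof.
case: n => [|n]; first by rewrite big_ord1 mul1r.
rewrite big_ord_recr /= {2}/bernoulli /= nth_rcons size_bernoulli_seq ltnn eqxx.
have -> : 'C(n.+2, n.+1) = n.+2 by rewrite binSn.
rewrite mulNr mulrN mulVKf ?pnatr_eq0//; apply/eqP; rewrite subr_eq0; apply/eqP.
by apply: eq_bigr => i _; rewrite nth_bernoulli_seq // -ltnS.
Qed.

Lemma bernoulli1 : bernoulli 1 = - (1 / 2).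
Proof.
have := bernoulli_rec 1; rewrite !big_ord_recr big_ord0 /= add0r mul1r => /eqP.
rewrite (_ : bernoulli 0 = 1) // addrC addr_eq0 => /eqP h.
by apply: (@mulfI _ 2) => //; rewrite h mulrN mul1r divff.
Qed.

Definition gbinom (R : realType) (a : R) (i : nat) : R :=
  (\prod_(j < i) (a - j%:R)) / i`!%:R.

(* Only meaningful for m >= 3, where the series converges. *)
Definition tau (R : realType) (n m : nat) : R :=
  limn (series (fun nu : nat =>
    ((Num.sqrt (n + nu)%:R + Num.sqrt (n + nu).+1%:R) ^+ m)^-1 : R)).

Definition Ppoly (R : realType) (k : nat) : {poly R} :=
  (k%:R / 2 + 1)^-1 *:
    \sum_(0 <= i < (k.+1)./2.+1)
      (gbinom (k%:R / 2 + 1) i * (-1) ^+ i * ratr (bernoulli i))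
        *: 'X^((k.+1)./2 - i).

(* For odd k and odd i <= k + 2, (k - i)/2 + 1 is written (k.+2 - i)./2, which
   is exact, whereas k - i would be truncated at i = k + 2. *)
Definition Acoef (R : realType) (k i : nat) : R :=
  ((k%:R / 2 + 1) * 2 ^+ i.-1)^-1 *
    \sum_(0 <= j < ((k.+2 - i)./2).+1)
      'C(2 * j + i, j)%:R * (4 ^+ j)^-1
        * gbinom (k%:R / 2 + 1) ((k.+2 - i)./2 - j)
        * ratr (bernoulli ((k.+2 - i)./2 - j)).

Definition Cconst (R : realType) (k : nat) : R :=
  1 - (Ppoly R k).[1]
    - \sum_(3 <= i < k.+3 | odd i) Acoef R k i * tau R 1 i.

(* Main.v *)
(* Put x = sqrt n, y = sqrt (n + 1) and t = y - x, so that x + y = 1 / t and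
   tau n i - tau (n + 1) i = t ^ i.  The formula then amounts to its increment
   from n to n + 1, an identity between Laurent polynomials in t, because
   y = (1 / t + t) / 2 and x = (1 / t - t) / 2.  Up to sign, all coefficients of
   this identity are built from the sums [half_coef d r], where t ^ (2 r + 1) is
   paired with d = (k + 1) / 2 - r.  The factorials in such a sum rearrange into
   those of Euler's beta integral, which turns it into a constant multiple of
       int_0^1 (u (1 - u)) ^ r B_d(u) du,
   with B_d the d-th Bernoulli polynomial.  This vanishes when d is odd, by the
   symmetry B_d(1 - u) = (-1) ^ d B_d(u), and when r = 0 < d; these are exactly
   the unwanted coefficients, namely the negative powers of t, the positive ones
   whose contributions from y and x cancel, and t ^ 1. *)
Require Import Defs.
From HB Require Import structures.
From mathcomp Require Import all_boot all_order all_algebra.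
From mathcomp Require Import all_classical all_reals all_analysis.
From mathcomp Require Import ring lra zify.
Import Order.TTheory GRing.Theory Num.Theory.
Import numFieldNormedType.Exports.
Local Open Scope ring_scope.

(** * Integration of polynomials over [0, 1] *)

Definition poly_int01 {F : numFieldType} (p : {poly F}) : F :=
  \sum_(i < size p) p`_i / i.+1%:R.

Lemma poly_int01E (F : numFieldType) (p : {poly F}) n : (size p <= n)%N ->
  poly_int01 p = \sum_(i < n) p`_i / i.+1%:R.
Proof.
move=> le_pn; rewrite /poly_int01 -(subnKC le_pn) big_split_ord /=.
rewrite [X in _ + X]big1 ?addr0// => i _.
by rewrite nth_default ?mul0r// leq_addr.
Qed.

Lemma poly_int01_is_linear (F : numFieldType) :
  linear (poly_int01 : {poly F} -> F^o).
Proof.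
move=> a p q; pose n := maxn (size (a *: p + q)) (maxn (size p) (size q)).
rewrite !(poly_int01E _ _ n) ?leq_max ?leqnn ?orbT//.
rewrite scaler_sumr -big_split /=; apply: eq_bigr => i _.
by rewrite coefD coefZ mulrDl -mulrA.
Qed.
HB.instance Definition _ (F : numFieldType) :=
  GRing.isLinear.Build F {poly F} F^o _ (@poly_int01 F) (poly_int01_is_linear F).

Lemma poly_int01Z (F : numFieldType) c (p : {poly F}) :
  poly_int01 (c *: p) = c * poly_int01 p.
Proof. exact: linearZ. Qed.

Lemma poly_int01B (F : numFieldType) (p q : {poly F}) :
  poly_int01 (p - q) = poly_int01 p - poly_int01 q.
Proof. exact: linearB. Qed.

Lemma poly_int01Xn (F : numFieldType) n :
  poly_int01 ('X^n : {poly F}) = n.+1%:R^-1.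
Proof.
rewrite (poly_int01E _ _ n.+1) ?size_polyXn// big_ord_recr /= coefXn eqxx.
rewrite div1r big1 ?add0r// => i _.
by rewrite coefXn ltn_eqF ?mul0r.
Qed.

Lemma poly_int01_deriv (F : numFieldType) (p : {poly F}) :
  poly_int01 p^`() = p.[1] - p.[0].
Proof.
elim/poly_ind: p => [|p c _]; first by rewrite deriv0 linear0 !horner0 subr0.
rewrite derivD derivC addr0 !hornerE addrK.
rewrite (poly_int01E _ _ (size p)); last first.
  rewrite (leq_trans (size_poly _ _))// -subn1 leq_subLR.
  by rewrite (leq_trans (size_polyMleq _ _))// size_polyX addn2 add1n.
rewrite horner_coef; apply: eq_bigr => i _.
rewrite coef_deriv coefMX /= expr1n mulr1.
by rewrite -(mulr_natr p`_i) mulfK ?pnatr_eq0.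
Qed.

Lemma poly_primitive (F : numFieldType) (p : {poly F}) :
  exists q : {poly F}, q^`() = p.
Proof.
exists (\poly_(i < (size p).+1) (p`_i.-1 / i%:R)).
apply/polyP => i; rewrite coef_deriv coef_poly ltnS /=.
case: ltnP => [_|le_pi]; last by rewrite mul0rn nth_default.
by rewrite -(mulr_natr (_ / _)) divfK ?pnatr_eq0.
Qed.

(** The substitution u -> 1 - u, read off from the endpoint values of a primitive. *)
Lemma poly_int01_comp1B (F : numFieldType) (p : {poly F}) :
  poly_int01 (p \Po (1 - 'X)) = poly_int01 p.
Proof.
have [q <-] := poly_primitive F p.
have := deriv_comp q (1 - 'X).
rewrite derivB derivX derivC sub0r mulrN1 => /(congr1 -%R); rewrite opprK => <-.
rewrite linearN /= !poly_int01_deriv !horner_comp !hornerE.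
by rewrite subrr subr0 opprB.
Qed.

Lemma poly_int01_beta (F : numFieldType) m r :
  poly_int01 ('X^m * (1 - 'X) ^+ r : {poly F}) =
    (m`! * r`!)%:R / (m + r).+1`!%:R.
Proof.
elim: r m => [|r IHr] m.
  rewrite expr0 mulr1 poly_int01Xn addn0 muln1 factS natrM invfM.
  by rewrite mulrCA divff ?mulr1 // pnatr_eq0 -lt0n fact_gt0.
(* Integration by parts; the recurrence raises m while lowering r. *)
have dX : ('X^(m.+1) * (1 - 'X) ^+ r.+1)^`() =
    m.+1%:R *: ('X^m * (1 - 'X) ^+ r.+1)
    - r.+1%:R *: ('X^(m.+1) * (1 - 'X) ^+ r) :> {poly F}.
  rewrite derivM derivXn deriv_exp derivB derivX derivC sub0r /=.
  by rewrite mulN1r mulNrn mulrN mulrnAl mulrnAr !scaler_nat.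
have := poly_int01_deriv F ('X^(m.+1) * (1 - 'X) ^+ r.+1).
rewrite dX !hornerE subrr !expr0n !(mulr0, mul0r) subrr poly_int01B !poly_int01Z.
move/eqP; rewrite subr_eq0 IHr => /eqP mr.
apply: (@mulfI _ m.+1%:R); first by rewrite pnatr_eq0.
rewrite [LHS]mr addSnnS !factS !natrM !mulrA.
by congr (_ / _); ring.
Qed.

(** * Bernoulli polynomials and their reflection symmetry *)

Definition bernoulli_poly {F : numFieldType} (n : nat) : {poly F} :=
  \sum_(i < n.+1) ('C(n, i)%:R * ratr (bernoulli i)) *: 'X^(n - i).

Lemma deriv_bernoulli_poly (F : numFieldType) n :
  (bernoulli_poly n.+1)^`() = n.+1%:R *: bernoulli_poly n :> {poly F}.
Proof.
rewrite /bernoulli_poly linear_sum big_ord_recr /= subnn expr0.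
rewrite derivZ derivC scaler0 addr0 scaler_sumr; apply: eq_bigr => i _.
rewrite derivZ derivXn subSn ?leq_ord//= -[_ *+ (n - i).+1]scaler_nat !scalerA.
congr (_ *: _).
rewrite mulrAC -natrM mulnC -subSn ?leq_ord// -mul_bin_down natrM.
by rewrite -mulrA.
Qed.

(** Since (n + 2) C(n + 1, i) / (n + 2 - i) = C(n + 2, i), the integral is, up to the factor n + 2,
    the sum in the recurrence of the Bernoulli numbers. *)
Lemma poly_int01_bernoulli_poly (F : numFieldType) n :
  poly_int01 (bernoulli_poly n.+1 : {poly F}) = 0.
Proof.
apply: (@mulfI _ n.+2%:R); first by rewrite pnatr_eq0.
transitivity (ratr (\sum_(i < n.+2) 'C(n.+2, i)%:R * bernoulli i) : F).
  rewrite linear_sum rmorph_sum mulr_sumr; apply: eq_bigr => i _.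
  rewrite /= poly_int01Z poly_int01Xn rmorphM /= ratr_nat.
  rewrite mulrA mulrA -natrM (mul_bin_down n.+2 i) subSn ?leq_ord//.
  by rewrite natrM -[_ * _ * ratr _]mulrA mulrAC mulfV ?mul1r// pnatr_eq0.
by rewrite bernoulli_rec rmorph0 mulr0.
Qed.

Lemma poly_deriv_int01_eq0 (F : numFieldType) (p : {poly F}) :
  p^`() = 0 -> poly_int01 p = 0 -> p = 0.
Proof.
move=> p'0; have pE : p = (p`_0)%:P.
  apply/polyP => -[|i]; rewrite coefC//=.
  have /eqP := congr1 (fun q : {poly F} => q`_i) p'0.
  by rewrite coef_deriv coef0 -mulr_natr mulf_eq0 pnatr_eq0 orbF => /eqP.
rewrite pE -alg_polyC poly_int01Z -[X in poly_int01 X](expr0 'X).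
by rewrite poly_int01Xn invr1 mulr1 => ->; rewrite scale0r.
Qed.

(** By induction both sides have the same derivative; both also have integral 0 once n > 0, so their
    difference is a constant with integral 0. *)
Lemma bernoulli_poly_comp1B (F : numFieldType) n :
  bernoulli_poly n \Po (1 - 'X) = (-1) ^+ n *: bernoulli_poly n :> {poly F}.
Proof.
elim: n => [|n IHn].
  by rewrite /bernoulli_poly big_ord1 !expr0 scale1r alg_polyC comp_polyC.
apply/eqP; rewrite -subr_eq0; apply/eqP; apply: poly_deriv_int01_eq0.
  rewrite derivB deriv_comp derivZ !deriv_bernoulli_poly linearZ /= IHn.
  rewrite derivB derivX derivC sub0r mulrN1 exprS mulN1r !scaleNr opprK.
  by rewrite !scalerA mulrC addNr.
by rewrite poly_int01B poly_int01Z poly_int01_comp1B poly_int01_bernoulli_poly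
           mulr0 subr0.
Qed.

(** * Half-integer binomials and the vanishing of [half_coef] *)

Lemma fact_neq0 (F : numFieldType) n : n`!%:R != 0 :> F.
Proof. by rewrite pnatr_eq0 -lt0n fact_gt0. Qed.

Lemma natr_bin (F : numFieldType) m n :
  'C(m + n, m)%:R = (m + n)`!%:R / (m`!%:R * n`!%:R) :> F.
Proof.
have := bin_fact (leq_addr n m); rewrite addKn => <-.
by rewrite !natrM mulfK// mulf_neq0 ?fact_neq0.
Qed.

(** The factors run from i + e + 1/2 down to e + 3/2. Splitting off the smallest leaves the product
    for e + 1, so the induction on i generalises e. *)
Lemma prod_half_falling (F : numFieldType) (i e : nat) :
  \prod_(j < i) ((i + e)%:R + 1 / 2 - j%:R) =
    ((i + e).*2.+1`! * e`!)%:R / (4 ^+ i * ((i + e)`! * e.*2.+1`!)%:R) :> F.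
Proof.
elim: i e => [|i IHi] e.
  by rewrite big_ord0 add0n expr0 mul1r mulnC divff// natrM mulf_neq0 ?fact_neq0.
rewrite big_ord_recr /= addSnnS IHi doubleS !factS !natrM exprS natrD.
have := fact_neq0 F e; have := fact_neq0 F e.*2.+1.
have := fact_neq0 F (i + e.+1); have : 4 ^+ i != 0 :> F by rewrite expf_neq0.
move: (4 ^+ i) (_`!%:R : F) (e.*2.+1`!%:R : F) (e`!%:R : F) => x a b c.
rewrite -!natr1 -!mul2n !natrM -!natr1.
set E : F := e%:R => x0 a0 b0 c0.
by field; rewrite fact_neq0 a0 x0 -natrM !natr1 !pnatr_eq0.
Qed.

Lemma gbinom_half (R : realType) (i e : nat) :
  gbinom ((i + e)%:R + 1 / 2 : R) i =
    ((i + e).*2.+1`! * e`!)%:R /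
      (4 ^+ i * ((i + e)`! * e.*2.+1`! * i`!)%:R).
Proof.
rewrite /gbinom prod_half_falling -mulrA -invfM; congr (_ / _).
by rewrite -mulrA -natrM.
Qed.

(* The coefficient of both t ^ (2 r + 1) and t ^ - (2 r + 1), up to a factor
   0 or 2, in the expansion of the left-hand side of [half_coef_expansion],
   with d + r = (k + 1) / 2. *)
Definition half_coef (R : realType) (d r : nat) : R :=
  \sum_(i < d.+1) gbinom ((d + r)%:R + 1 / 2) i * ratr (bernoulli i)
    * 'C((d - i + r).*2.+1, d - i)%:R / 2 ^+ (d - i + r).*2.+1.

Lemma poly_int01_beta_bernoulli (F : numFieldType) d r :
  poly_int01 ('X^r * (1 - 'X) ^+ r * bernoulli_poly d : {poly F}) =
    \sum_(i < d.+1) 'C(d, i)%:R * ratr (bernoulli i)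
      * ((d - i + r)`! * r`!)%:R / (d - i + r + r).+1`!%:R.
Proof.
rewrite /bernoulli_poly mulr_sumr linear_sum; apply: eq_bigr => i _.
rewrite /= -scalerAr poly_int01Z ['X^r * _ * _]mulrAC -exprD addnC.
by rewrite poly_int01_beta mulrA.
Qed.

Lemma half_coefE (R : realType) d r :
  half_coef R d r =
    (d + r).*2.+1`!%:R / (4 ^+ d * 2 ^+ r.*2.+1 * ((d + r)`! * d`! * r`!)%:R) *
    poly_int01 ('X^r * (1 - 'X) ^+ r * bernoulli_poly d).
Proof.
rewrite poly_int01_beta_bernoulli mulr_sumr; apply: eq_bigr => i _.
(* Writing d = i + e removes the truncated subtractions and brings the binomial into the form of
   [gbinom_half]. *)
case: i => i /= lt_id; have [e ->] : exists e, d = (i + e)%N.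
  by exists (d - i)%N; rewrite subnKC.
rewrite addKn -addnA gbinom_half.
have binE : 'C((e + r).*2.+1, e)%:R =
    (e + r).*2.+1`!%:R / (e`!%:R * (e + r + r).+1`!%:R) :> R.
  have -> : (e + r).*2.+1 = (e + (e + r + r).+1)%N by rewrite -addnn; lia.
  exact: natr_bin.
have powE : 2 ^+ (e + r).*2.+1 = 4 ^+ e * 2 ^+ r.*2.+1 :> R.
  have -> : (4 : R) = 2 ^+ 2 by rewrite -natrX.
  by rewrite -exprM -exprD; congr (_ ^+ _); rewrite -!addnn; lia.
rewrite binE powE natr_bin exprD.
have p2 n : 2 ^+ n != 0 :> R by rewrite expf_neq0.
have p4 n : 4 ^+ n != 0 :> R by rewrite expf_neq0.
have := fact_neq0 R (e + r + r).+1; have := fact_neq0 R (e + r).*2.+1.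
move: (e + r + r).+1`! (e + r).*2.+1`! => b c c0 b0; rewrite !natrM.
by field; rewrite !fact_neq0 b0 c0 !p2 !p4.
Qed.

Lemma half_coef_odd (R : realType) d r : odd d -> half_coef R d r = 0.
Proof.
move=> d_odd; rewrite half_coefE; set p := (_ * bernoulli_poly d).
suff -> : poly_int01 p = 0 by rewrite mulr0.
have : poly_int01 p = - poly_int01 p.
  rewrite -{1}poly_int01_comp1B -[RHS]mulN1r -poly_int01Z /p.
  rewrite !comp_polyM bernoulli_poly_comp1B -signr_odd d_odd expr1 -scalerAr.
  rewrite comp_Xn_poly rmorphXn /= comp_polyB comp_polyX.
  by rewrite -polyC1 comp_polyC polyC1 subKr [(1 - 'X) ^+ r * _]mulrC.
by move/eqP; rewrite -addr_eq0 -mulr2n mulrn_eq0 /= => /eqP.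
Qed.

Lemma half_coef_gt0_r0 (R : realType) d : half_coef R d.+1 0 = 0.
Proof.
by rewrite half_coefE !expr0 !mul1r poly_int01_bernoulli_poly mulr0.
Qed.

(** * Bernoulli numbers of odd index *)

Lemma bernoulli_odd (n : nat) : odd n -> (1 < n)%N -> bernoulli n = 0.
Proof.
case: n => [//|n n_odd n_gt0].
have ratr_id x : ratr x = x :> rat by rewrite -(fmorph_eq_rat idfun).
(* The values of the Bernoulli polynomial at 0 and 1 both equal the Bernoulli number, at 1 thanks to
   the recurrence; the reflection in odd degree makes them opposite. *)
have /(congr1 (fun p : {poly rat} => p.[0])) := bernoulli_poly_comp1B rat n.+1.
rewrite horner_comp hornerZ !hornerE.
have -> : (bernoulli_poly n.+1).[0] = bernoulli n.+1.
  rewrite /bernoulli_poly horner_sum big_ord_recr /= big1 ?add0r => [|i _].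
    by rewrite subnn binn expr0 !hornerE ratr_id.
  by rewrite !hornerE expr0n subn_eq0 leqNgt ltn_ord mulr0.
have -> : (bernoulli_poly n.+1).[1] = bernoulli n.+1.
  rewrite /bernoulli_poly horner_sum big_ord_recr /=.
  rewrite [X in X + _](_ : _ = 0) ?add0r; last first.
    transitivity ((n == 0)%:R : rat); last by rewrite gtn_eqF.
    rewrite -bernoulli_rec; apply: eq_bigr => i _.
    by rewrite hornerZ hornerXn expr1n mulr1 ratr_id.
  by rewrite binn hornerZ hornerXn expr1n mulr1 mul1r ratr_id.
rewrite -signr_odd n_odd expr1 mulN1r => /eqP.
by rewrite -addr_eq0 -mulr2n mulrn_eq0 /= => /eqP.
Qed.

(* The only odd-indexed term affected by the sign is B_1 = - 1 / 2. *)
Lemma bernoulli_sign_sum (F : numFieldType) n (c : nat -> F) :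
  \sum_(i < n.+2) c i * ((-1) ^+ i * ratr (bernoulli i)) =
    \sum_(i < n.+2) c i * ratr (bernoulli i) + c 1.
Proof.
rewrite -(big_mkord xpredT (fun i => c i * ((-1) ^+ i * ratr (bernoulli i)))).
rewrite -(big_mkord xpredT (fun i => c i * ratr (bernoulli i))).
do 2!rewrite big_nat_recl// big_nat_recl// /=.
have -> : ratr (bernoulli 1) = - (1 / 2) :> F.
  by rewrite bernoulli1 rmorphN fmorph_div rmorph1 -[2 in RHS]ratr_nat.
rewrite expr0 expr1.
rewrite (eq_big_nat _ _ (F2 := fun i => c i.+2 * ratr (bernoulli i.+2))).
  by field.
move=> i _; congr (_ * _); have [i_odd|i_even] := boolP (odd i).
  by rewrite bernoulli_odd ?rmorph0 ?mulr0 //= negbK.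
by rewrite -signr_odd /= negbK (negbTE i_even) expr0 mul1r.
Qed.

(** * Expansion of the increment in powers of t *)

Lemma exprD_odd_fold (A : comPzRingType) (t u : A) q :
  (t + u) ^+ q.*2.+1 =
    \sum_(e < q.+1) 'C(q.*2.+1, e)%:R * (u * t) ^+ e
      * (t ^+ (q - e).*2.+1 + u ^+ (q - e).*2.+1).
Proof.
rewrite exprDn; have -> : (q.*2.+2 = q.+1 + q.+1)%N by rewrite addSn addnS addnn.
(* An odd exponent gives an even number of terms, so each term of the first half pairs with its
   mirror image in the second. *)
rewrite big_split_ord /= [X in _ + X](reindex_inj rev_ord_inj) -big_split /=.
apply: eq_bigr => -[e /= lt_eq] _.
have [d ->] : exists d, q = (e + d)%N by exists (q - e)%N; rewrite subnKC.
have -> : ((e + d).+1 + ((e + d).+1 - e.+1) = (e + d).*2.+1 - e)%N.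
  by rewrite -addnn; lia.
rewrite bin_sub; last by rewrite -addnn; lia.
rewrite subKn; last by rewrite -addnn; lia.
have -> : ((e + d).*2.+1 - e = e + d.*2.+1)%N by rewrite -!addnn; lia.
by rewrite addKn -mulrnDl -[LHS]mulr_natl !exprD exprMn; ring.
Qed.

Lemma sum_triangle (A : nmodType) (f : nat -> nat -> A) m :
  \sum_(i < m.+1) \sum_(e < (m - i).+1) f i e =
    \sum_(d < m.+1) \sum_(i < d.+1) f i (d - i)%N.
Proof.
elim: m => [|m IHm]; first by rewrite !big_ord1.
rewrite [RHS]big_ord_recr -IHm [LHS]big_ord_recr [X in _ = _ + X]big_ord_recr.
rewrite /= subnn big_ord1 addrA -big_split.
congr (_ + _); apply: eq_bigr => i _ /=.
by rewrite subSn ?leq_ord// big_ord_recr.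
Qed.

Lemma half_coef_expansion (R : realType) m (t u x y : R) :
  u * t = 1 -> y = (t + u) / 2 -> x = (u - t) / 2 ->
  \sum_(i < m.+2) gbinom (m.+1%:R + 1 / 2) i * ratr (bernoulli i)
      * y ^+ (m.+1 - i).*2.+1
  - \sum_(i < m.+2) gbinom (m.+1%:R + 1 / 2) i * ((-1) ^+ i * ratr (bernoulli i))
      * x ^+ (m.+1 - i).*2.+1
  = \sum_(r < m.+1) 2 * half_coef R (m - r) r.+1 * t ^+ r.+1.*2.+1.
Proof.
move=> ut yE xE; rewrite -sumrB.
pose g i := gbinom (m.+1%:R + 1 / 2 : R) i * ratr (bernoulli i).
pose s d := (m.+1 - d).*2.+1.
(* For d = i + e, the y-sum contributes t ^ s + u ^ s, and the x-sum, with its sign (-1) ^ i,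
   subtracts (-1) ^ d (u ^ s - t ^ s). *)
pose T d := (1 + (-1) ^+ d) * t ^+ s d + (1 - (-1) ^+ d) * u ^+ s d.
transitivity (\sum_(i < m.+2) \sum_(e < (m.+1 - i).+1)
    g i * 'C((m.+1 - i).*2.+1, e)%:R / 2 ^+ (m.+1 - i).*2.+1 * T (i + e)%N).
  apply: eq_bigr => i _; rewrite yE xE !expr_div_n.
  rewrite [u - t]addrC !exprD_odd_fold ut mulrN ut.
  rewrite !mulr_suml !mulr_sumr -sumrB; apply: eq_bigr => e _.
  rewrite -/(g i) /T /s subnDA expr1n [(- t) ^+ _]exprNn.
  by rewrite -[(-1) ^+ _.*2.+1]signr_odd /= odd_double /= exprD /g; ring.
(* Grouping by d = i + e collects equal powers; their coefficient is then [half_coef]. *)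
rewrite (sum_triangle _ (fun i e => g i * 'C((m.+1 - i).*2.+1, e)%:R
  / 2 ^+ (m.+1 - i).*2.+1 * T (i + e)%N)).
transitivity (\sum_(d < m.+2) half_coef R d (m.+1 - d) * T d).
  apply: eq_bigr => d _; rewrite /half_coef mulr_suml; apply: eq_bigr => i _.
  have le_dm := leq_ord d; have le_id : (i <= d)%N := leq_ord i.
  rewrite (subnKC le_id) (subnKC le_dm).
  by have -> : (d - i + (m.+1 - d) = m.+1 - i)%N by lia.
(* The term d = m + 1, which carries the first powers of t and u, vanishes. So do those with d odd,
   and for d even [T d] is just 2 t ^ s. *)
rewrite big_ord_recr /= subnn half_coef_gt0_r0 mul0r addr0.
rewrite (reindex_inj rev_ord_inj) /=; apply: eq_bigr => r _.
rewrite subSS; have le_rm := leq_ord r.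
have -> : (m.+1 - (m - r) = r.+1)%N by lia.
have [d_odd|/negbTE d_even] := boolP (odd (m - r)).
  by rewrite half_coef_odd// !(mulr0, mul0r).
rewrite /T /s -signr_odd d_even expr0 subrr mul0r addr0.
have -> : (m.+1 - (m - r) = r.+1)%N by lia.
by ring.
Qed.

(** * Convergence of the series [tau] and its shift in n *)

Lemma sqrtrS_sqr (R : realType) (n : nat) :
  Num.sqrt n.+1%:R ^+ 2 = Num.sqrt n%:R ^+ 2 + 1 :> R.
Proof. by rewrite !sqr_sqrtr ?ler0n// -natr1. Qed.

Lemma sqrtr_sum_ge1 (R : realType) (n : nat) :
  1 <= Num.sqrt n%:R + Num.sqrt n.+1%:R :> R.
Proof.
apply: (@le_trans _ _ (Num.sqrt n.+1%:R)); last by rewrite lerDr sqrtr_ge0.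
by rewrite -[leLHS]sqrtr1 ler_sqrt ?ler1n.
Qed.

(* 1 / (x + y) ^ 3 = (y - x) / (x + y) ^ 2, which makes the bound telescope. *)
Lemma tau_term_le (R : realType) (n m : nat) : (3 <= m)%N ->
  ((Num.sqrt n%:R + Num.sqrt n.+1%:R) ^+ m)^-1 <=
    3 * ((1 + Num.sqrt n%:R)^-1 - (1 + Num.sqrt n.+1%:R)^-1) :> R.
Proof.
move=> m_ge3; have := sqrtr_sum_ge1 R n; have := sqrtrS_sqr R n.
have := sqrtr_ge0 (n%:R : R); have := sqrtr_ge0 (n.+1%:R : R).
move: (Num.sqrt n%:R) (Num.sqrt n.+1%:R) => x y y0 x0 xy s1.
have s0 : 0 < x + y by lra.
apply: (@le_trans _ _ ((x + y) ^+ 3)^-1).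
  by rewrite lef_pV2 ?posrE ?exprn_gt0// ler_weXn2l.
have -> : (1 + x)^-1 - (1 + y)^-1 = (y - x) / ((1 + x) * (1 + y)).
  by field; rewrite !gt_eqF//; lra.
have -> : y - x = (x + y)^-1.
  apply: (@mulfI _ (x + y)); first by rewrite gt_eqF.
  by rewrite mulfV ?gt_eqF//; nra.
have p0 : 0 < (1 + x) * (1 + y) by rewrite mulr_gt0//; lra.
rewrite -invfM ler_pdivlMr; last exact: mulr_gt0.
rewrite mulrC ler_pdivrMr ?exprn_gt0//.
have -> : 3 * (x + y) ^+ 3 = (x + y) * (3 * (x + y) ^+ 2) by ring.
by rewrite ler_pM2l//; nra.
Qed.

Definition tau_term (R : realType) (n m nu : nat) : R :=
  ((Num.sqrt (n + nu)%:R + Num.sqrt (n + nu).+1%:R) ^+ m)^-1.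

Lemma tau_term_ge0 (R : realType) n m nu : 0 <= tau_term R n m nu.
Proof. by rewrite invr_ge0 exprn_ge0// addr_ge0 ?sqrtr_ge0. Qed.

(** The terms are nonnegative, and telescoping [tau_term_le] bounds the partial sums by 3 / (1 +
    sqrt n). *)
Lemma cvg_tau (R : realType) (n m : nat) : (3 <= m)%N ->
  cvgn (series (tau_term R n m)).
Proof.
move=> m_ge3; pose h nu : R := (1 + Num.sqrt (n + nu)%:R)^-1.
apply: nondecreasing_is_cvgn.
  by apply: nondecreasing_series => nu _ _; exact: tau_term_ge0.
exists (3 * h 0) => _ [N _ <-].
apply: (@le_trans _ _ (\sum_(0 <= nu < N) 3 * (h nu - h nu.+1))).
  by apply: ler_sum => nu _; rewrite /h addnS; exact: tau_term_le.
rewrite -mulr_sumr (telescope_sumr_eq (fun nu => - h nu))//; last first.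
  by move=> nu _; rewrite opprK addrC.
rewrite opprK addrC ler_pM2l// lerBlDr lerDl.
by rewrite invr_ge0 addr_ge0 ?sqrtr_ge0.
Qed.

Lemma tauS (R : realType) (n m : nat) : (3 <= m)%N ->
  tau R n m = ((Num.sqrt n%:R + Num.sqrt n.+1%:R) ^+ m)^-1 + tau R n.+1 m.
Proof.
move=> m_ge3; apply: cvg_lim => //; rewrite -cvg_shiftS.
have -> : [sequence series (tau_term R n m) N.+1]_N =
    (fun N => tau_term R n m 0 + series (tau_term R n.+1 m) N).
  apply/funext => N /=; rewrite /series /= big_nat_recl//; congr (_ + _).
  by apply: eq_bigr => nu _; rewrite /tau_term addSnnS.
rewrite /tau_term addn0; apply: cvgD; first exact: cvg_cst.
exact: cvg_tau.
Qed.

(** * Rewriting the formula for k = 2 p + 1 *)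

Lemma sum_odd_ge3 (A : nmodType) (f : nat -> A) p :
  \sum_(3 <= i < p.*2.+1.+3 | odd i) f i = \sum_(r < p.+1) f r.+1.*2.+1.
Proof.
elim: p => [|p IHp]; first by rewrite big_ord1 big_mkcond big_nat1.
rewrite [RHS]big_ord_recr -IHp doubleS big_mkcond 2?big_nat_recr//= !negbK.
by rewrite odd_double /= addr0 -big_mkcond.
Qed.

Lemma natr_half_neq0 (F : numFieldType) n : n%:R + 1 / 2 != 0 :> F.
Proof. by rewrite gt_eqF// ltr_wpDl// divr_gt0. Qed.

(** Reversing the sum over j turns the definition of [Acoef] into that of [half_coef], once the
    denominator k / 2 + 1 is cleared. *)
Lemma Acoef_half (R : realType) p r : (r <= p.+1)%N ->
  (p.+1%:R + 1 / 2) * Acoef R p.*2.+1 r.*2.+1 = 2 * half_coef R (p.+1 - r) r.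
Proof.
move=> le_rp; have a_neq0 := natr_half_neq0 R p.+1.
rewrite /Acoef /half_coef subnK//.
have -> : p.*2.+1%:R / 2 + 1 = p.+1%:R + 1 / 2 :> R.
  by rewrite -!natr1 -muln2 natrM; field.
have -> : ((p.*2.+3 - r.*2.+1)./2 = p.+1 - r)%N by lia.
rewrite invfM !mulrA mulfV// mul1r big_mkord !mulr_sumr.
rewrite (reindex_inj rev_ord_inj) /=; apply: eq_bigr => -[i /= lt_i] _.
rewrite subSS subKn; last by rewrite -ltnS.
move: (p.+1 - r - i)%N => e.
have -> : (2 * e + r.*2.+1 = (e + r).*2.+1)%N by rewrite doubleD mul2n addnS.
have -> : 2 ^+ (e + r).*2.+1 = 2 * 4 ^+ e * 2 ^+ r.*2 :> R.
  have -> : (4 : R) = 2 ^+ 2 by rewrite -natrX.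
  by rewrite -exprM -exprS -exprD; congr (_ ^+ _); rewrite -!addnn; lia.
have p2 : 2 ^+ r.*2 != 0 :> R by rewrite expf_neq0.
have p4 : 4 ^+ e != 0 :> R by rewrite expf_neq0.
by field; rewrite p2 p4.
Qed.

Lemma gbinom1 (R : realType) (a : R) : gbinom a 1 = a.
Proof. by rewrite /gbinom big_ord1 subr0 divr1. Qed.

(** Absorbing the factor sqrt n leaves odd powers of sqrt n, as in the signed sum of
    [half_coef_expansion]. *)
Lemma sqrt_Ppoly (R : realType) p n :
  (p.+1%:R + 1 / 2) * (Num.sqrt n%:R * (Ppoly R p.*2.+1).[n%:R]) =
    \sum_(i < p.+2) gbinom (p.+1%:R + 1 / 2) i
      * ((-1) ^+ i * ratr (bernoulli i)) * Num.sqrt n%:R ^+ (p.+1 - i).*2.+1.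
Proof.
have a_neq0 := natr_half_neq0 R p.+1.
rewrite /Ppoly; have -> : p.*2.+1%:R / 2 + 1 = p.+1%:R + 1 / 2 :> R.
  by rewrite -!natr1 -muln2 natrM; field.
rewrite hornerZ [Num.sqrt _ * _]mulrCA mulVKf//.
rewrite -doubleS doubleK horner_sum big_mkord mulr_sumr.
apply: eq_bigr => i _; rewrite hornerZ hornerXn.
rewrite -[in X in _ * X = _](@sqr_sqrtr _ (n%:R : R)) ?ler0n//.
by rewrite -exprM mul2n exprS; ring.
Qed.

Lemma powR_half_odd (R : realType) p n :
  (n%:R : R) `^ (p.*2.+1%:R / 2) = Num.sqrt n%:R ^+ p.*2.+1.
Proof. by rewrite mulrC powRrM powR12_sqrt// powR_mulrn// sqrtr_ge0. Qed.

(** * The increment in n and the final induction *)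

Definition sum_formula (R : realType) (k n : nat) : R :=
  Num.sqrt n%:R * (Ppoly R k).[n%:R]
    + \sum_(3 <= i < k.+3 | odd i) Acoef R k i * tau R n i.

Lemma sum_formulaS (R : realType) (k n : nat) : odd k ->
  sum_formula R k n.+1 = sum_formula R k n + n.+1%:R `^ (k%:R / 2).
Proof.
move=> k_odd; have [p ->] : exists p, k = p.*2.+1.
  by exists k./2; rewrite -[LHS]odd_double_half k_odd.
rewrite /sum_formula powR_half_odd !sum_odd_ge3.
set x : R := Num.sqrt n%:R; set y : R := Num.sqrt n.+1%:R.
have xy : y ^+ 2 = x ^+ 2 + 1 by exact: sqrtrS_sqr.
have xy_neq0 : x + y != 0 by rewrite gt_eqF// (lt_le_trans _ (sqrtr_sum_ge1 _ _)).
have xyK : (x + y) * (y - x) = 1 by rewrite -[1](addKr (x ^+ 2)) -xy; ring.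
have xyV : (x + y)^-1 = y - x.
  by apply: (mulfI xy_neq0); rewrite mulfV.
have a_neq0 := natr_half_neq0 R p.+1.
have -> : \sum_(r < p.+1) Acoef R p.*2.+1 r.+1.*2.+1 * tau R n r.+1.*2.+1 =
    \sum_(r < p.+1) Acoef R p.*2.+1 r.+1.*2.+1 * (y - x) ^+ r.+1.*2.+1
    + \sum_(r < p.+1) Acoef R p.*2.+1 r.+1.*2.+1 * tau R n.+1 r.+1.*2.+1.
  rewrite -big_split; apply: eq_bigr => r _ /=.
  by rewrite tauS ?doubleS// -/x -/y -exprVn xyV mulrDr.
apply: (mulfI a_neq0); rewrite !mulrDr !sqrt_Ppoly -/x -/y.
rewrite [X in _ = _ + (X + _) + _]mulr_sumr.
rewrite [X in _ = _ + (X + _) + _](_ : _ =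
  \sum_(r < p.+1) 2 * half_coef R (p - r) r.+1 * (y - x) ^+ r.+1.*2.+1);
  last first.
  by apply: eq_bigr => r _; rewrite mulrA Acoef_half ?subSS// ltnS leq_ord.
rewrite -(@half_coef_expansion _ _ _ (x + y) x y)//; last 2 first.
- by field.
- by field.
(* [half_coef_expansion] has unsigned Bernoulli numbers at y, whereas [Ppoly] has signed ones. The
   discrepancy, from B_1 alone, is (k / 2 + 1) y ^ k: the new summand (n + 1) ^ (k / 2), scaled. *)
have := bernoulli_sign_sum R p
  (fun i => gbinom (p.+1%:R + 1 / 2 : R) i * y ^+ (p.+1 - i).*2.+1).
rewrite subSS subn0 gbinom1.
under eq_bigr do rewrite mulrAC.
under [in X in _ = X + _ -> _]eq_bigr do rewrite mulrAC.
move=> ->; ring.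
Qed.

Theorem theorem1 (R : realType) (k : nat) (k_odd : odd k) (n : nat) :
  \sum_(1 <= i < n.+1) (i%:R : R) `^ (k%:R / 2) =
    Cconst R k + Num.sqrt (n%:R : R) * (Ppoly R k).[n%:R]
      + \sum_(3 <= i < k.+3 | odd i) Acoef R k i * tau R n i.
Proof.
(* [Cconst] is normalised at n = 1; the increment from 0 to 1 moves this to n = 0, where the sum is
   empty. *)
have CE : Cconst R k = - sum_formula R k 0.
  have := sum_formulaS R k 0 k_odd; rewrite powR1 {1}/sum_formula sqrtr1 mul1r.
  by rewrite /Cconst => H; rewrite -addrA -opprD H; ring.
rewrite -addrA -/(sum_formula R k n) CE.
elim: n => [|n IHn]; first by rewrite big_geq// addNr.
by rewrite big_nat_recr//= IHn sum_formulaS// -addrA.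
Qed.
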